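(* Let $L\in\mathbb{Z}_{\ge2}$ and $P,N>0$ with $N\le\frac{L-1}{L}P$. Then $$\overline{C}_{L-1}(P,N)\ge\frac12\ln\frac{(L-1)^2P^2}{LN\left(2(L-1)P-LN\right)}.$$
   Context: $\mathcal{B}^n(r)$ is the closed Euclidean ball of radius $r$ centered at the origin. For $x_1,\dots,x_L\in\mathbb{R}^n$ with centroid $\bar x=\frac1L\sum_ix_i$, $\overline{\mathrm{rad}}^2(x_1,\dots,x_L)=\frac1L\sum_i\|x_i-\bar x\|_2^2$. A finite $\mathcal{C}\subseteq\mathcal{B}^n(\sqrt{nP})$ is $(P,N,L-1)$-average-radius list-decodable if every $L$ distinct points of $\mathcal{C}$ have $\overline{\mathrm{rad}}^2>nN$. Rate $R(\mathcal{C})=\frac1n\ln|\mathcal{C}|$. $\overline{C}_{L-1}(P,N)=\limsup_{n\to\infty}\sup R(\mathcal{C})$ over such codes in $\mathcal{B}^n(\sqrt{nP})$. *)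

(* Defs.v *)
From HB Require Import structures.
From mathcomp Require Import all_boot all_order all_algebra.
From mathcomp Require Import all_classical all_reals all_analysis.
Set Implicit Arguments. Unset Strict Implicit. Unset Printing Implicit Defensive.
Import Order.TTheory GRing.Theory Num.Theory.
Local Open Scope classical_set_scope.
Local Open Scope ring_scope.

Section Defs.
Variable R : realType.

Definition sqnorm (n : nat) (x : 'rV[R]_n) : R := \sum_(j < n) (x 0 j) ^+ 2.

Definition inBall (n : nat) (r : R) (x : 'rV[R]_n) : Prop := sqnorm x <= r ^+ 2.

Definition centroid (n L : nat) (x : 'I_L -> 'rV[R]_n) : 'rV[R]_n :=
  L%:R^-1 *: \sum_(i < L) x i.

Definition avgrad2 (n L : nat) (x : 'I_L -> 'rV[R]_n) : R :=
  L%:R^-1 * \sum_(i < L) sqnorm (x i - centroid x).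

Definition codeInBall (n : nat) (P : R) (C : seq 'rV[R]_n) : Prop :=
  uniq C /\ forall x, x \in C -> inBall (Num.sqrt (n%:R * P)) x.

(* (P,N,L-1)-average-radius list-decodable: every L distinct points of C
   have average squared radius > nN. *)
Definition avgRadListDec (n : nat) (P N : R) (L : nat) (C : seq 'rV[R]_n) : Prop :=
  codeInBall P C /\
  forall x : 'I_L -> 'rV[R]_n, injective x -> (forall i, x i \in C) ->
    avgrad2 x > n%:R * N.

Definition rate (n : nat) (C : seq 'rV[R]_n) : R := n%:R^-1 * ln (size C)%:R.

Definition bestRate (P N : R) (L : nat) (n : nat) : \bar R :=
  ereal_sup [set (rate C)%:E | C in [set C : seq 'rV[R]_n | avgRadListDec P N L C]].

Definition capListDec (P N : R) (L : nat) : \bar R :=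
  limn_esup (bestRate P N L).

End Defs.

(* Main.v *)
(** If all pairs of distinct points of a code on the sphere of squared radius
[nP] have inner product below [c nP], where [1 - c = LN / ((L-1) P)], then
every [L] of them have average squared radius above
[(L-1)/L * (1-c) nP = nN]; so it suffices to have spherical codes of rate
about [- ln (1 - c^2) / 2].  Such codes are obtained greedily from the integer
points of a ball, each lifted to the sphere one dimension higher: the points
whose lift has cosine at least [c] with the lift of [x] lie in the ball
centred at [c x] whose radius is smaller by the factor [sqrt (1 - c^2)].  The
comparison of volumes is done by counting integer points, with [c] and
[sqrt (1 - c^2)] approximated by fractions [p / k] and [l / k] such that
[k^2 < p^2 + l^2]. *)
Require Import Defs.
From HB Require Import structures.
From mathcomp Require Import all_boot all_order all_algebra.
From mathcomp Require Import all_classical all_reals all_analysis.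
From mathcomp Require Import zify ring lra.
Set Implicit Arguments. Unset Strict Implicit. Unset Printing Implicit Defensive.
Import Order.TTheory GRing.Theory Num.Theory.
Local Open Scope ring_scope.

(** * Counting integer points in balls and caps *)

(* A point [u] stands for the integer vector [coord u], with entries in
   [-s, s]; this box contains the ball of squared radius [s]. *)
Definition grid (n s : nat) := {ffun 'I_n -> 'I_(s.*2.+1)}.

Definition coord (n s : nat) (u : grid n s) (j : 'I_n) : int :=
  (u j : nat)%:Z - s%:Z.

Definition grid_ball (n s : nat) : {set grid n s} :=
  [set u | \sum_j coord u j ^+ 2 <= s%:Z].

Lemma coord_inj (n s : nat) (u v : grid n s) :
  coord u =1 coord v -> u = v.
Proof.
by move=> E; apply/ffunP => j; apply: val_inj; have := E j; rewrite /coord /=; lia.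
Qed.

Lemma gridP (n s : nat) (f : 'I_n -> int) :
  (forall j, `|f j| <= s%:Z) -> exists u : grid n s, coord u =1 f.
Proof.
move=> H; exists [ffun j => inord (absz (f j + s%:Z))] => j.
by have Hj := H j; rewrite /coord ffunE inordK; lia.
Qed.

(** An integer satisfies [|f j| <= f j ^+ 2], so a vector of squared norm at most [s] fits in the
    box. *)
Lemma grid_ballP (n s : nat) (f : 'I_n -> int) :
  \sum_j f j ^+ 2 <= s%:Z ->
  exists2 u : grid n s, u \in grid_ball n s & coord u =1 f.
Proof.
move=> H.
have [u Hu] : exists u : grid n s, coord u =1 f.
  apply: gridP => j.
  have : f j ^+ 2 <= s%:Z.
    apply: le_trans H; rewrite (bigD1 j) //= lerDl sumr_ge0 // => i _.
    exact: sqr_ge0.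
  by rewrite expr2; nia.
by exists u => //; rewrite inE; under eq_bigr do rewrite Hu.
Qed.

(* Each unit cell is refined into [k^n] points, and the refined points are
   regrouped into cells of side [l]: this replaces a change of scale [k / l]
   of the volume. *)
Lemma card_rescale (n s k l : nat) (w : 'I_n -> int) (A B : {set grid n s}) :
  (0 < k)%N -> (0 < l)%N ->
  (forall u, u \in A -> forall v : 'I_n -> int,
     (forall j, `|l%:Z * v j - (k%:Z * coord u j - w j)| <= (k + l)%:Z) ->
     exists2 b, b \in B & coord b =1 v) ->
  (#|A| * k ^ n <= #|B| * l ^ n)%N.
Proof.
case: k => // k _; case: l => // l _ H.
(* [z q] is a refined point at scale [k], seen from [w]; [F] records its cell of side [l] and its
   position in that cell. *)
pose z (q : grid n s * {ffun 'I_n -> 'I_k.+1}) j : int :=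
  k.+1%:Z * coord q.1 j + (q.2 j : nat)%:Z - w j.
pose F q : grid n s * {ffun 'I_n -> 'I_l.+1} :=
  ([ffun j => inord (absz ((z q j %/ l.+1%:Z)%Z + s%:Z))],
   [ffun j => inord (absz (z q j %% l.+1%:Z)%Z)]).
pose D := finset.setX A [set: {ffun 'I_n -> 'I_k.+1}].
have zE q j : z q j = (z q j %/ l.+1%:Z)%Z * l.+1%:Z + (z q j %% l.+1%:Z)%Z.
  exact: divz_eq.
have mge q j : 0 <= (z q j %% l.+1%:Z)%Z by apply: modz_ge0.
have mlt q j : (z q j %% l.+1%:Z)%Z < l.+1%:Z by apply: ltz_pmod.
have FP q : q \in D -> (F q).1 \in B /\
    coord (F q).1 =1 (fun j => (z q j %/ l.+1%:Z)%Z).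
  case: q => u a; rewrite /D inE /= => /andP[uA _].
  (* The cell corner differs from [k * coord u - w] by the offset [a j], below [k], minus a
     remainder below [l]. *)
  have [j|b bB bE] := H u uA (fun j => (z (u, a) j %/ l.+1%:Z)%Z).
    have := zE (u, a) j; have := mge (u, a) j; have := mlt (u, a) j.
    have := ltn_ord (a j); rewrite /z /=; lia.
  suff -> : [ffun j => inord (absz ((z (u, a) j %/ l.+1%:Z)%Z + s%:Z))] = b by [].
  apply/ffunP => j; apply: val_inj; rewrite ffunE -bE /coord.
  by rewrite subrK absz_nat inord_val.
have Finj : {in D &, injective F}.
  move=> q q' qD q'D E.
  have E1 j : (z q j %/ l.+1%:Z)%Z = (z q' j %/ l.+1%:Z)%Z.
    by rewrite -(FP q qD).2 -(FP q' q'D).2 E.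
  have E2 j : (z q j %% l.+1%:Z)%Z = (z q' j %% l.+1%:Z)%Z.
    have := congr1 (fun x : grid n s * {ffun 'I_n -> 'I_l.+1} =>
      (x.2 j : nat)) E.
    have := (mge q j, mlt q j, mge q' j, mlt q' j) => -[[[]]] ? ? ? ?.
    by rewrite /F /= !ffunE !inordK; lia.
  have Ez j : z q j = z q' j by rewrite zE E1 E2 -zE.
  have Eq j : coord q.1 j = coord q'.1 j /\ q.2 j = q'.2 j :> nat.
    have := Ez j; have := ltn_ord (q.2 j); have := ltn_ord (q'.2 j).
    rewrite /z; move: (coord q.1 j) (coord q'.1 j) => c c'.
    move: (nat_of_ord (q.2 j)) (nat_of_ord (q'.2 j)) => e e' ? ? E'.
    have cc' : c = c'.
      have [?|?|//] := ltgtP c c'.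
        have : k.+1%:Z * (c + 1) <= k.+1%:Z * c' by rewrite ler_pM2l //; lia.
        lia.
      have : k.+1%:Z * (c' + 1) <= k.+1%:Z * c by rewrite ler_pM2l //; lia.
      lia.
    by split=> //; move: E'; rewrite cc'; lia.
  case: q q' Eq {qD q'D E E1 E2 Ez} => [u a] [u' a'] /= Eq.
  congr pair; first by apply: coord_inj => j; case: (Eq j).
  by apply/ffunP => j; apply: val_inj; case: (Eq j).
have : (#|D| <= #|finset.setX B [set: {ffun 'I_n -> 'I_l.+1}]|)%N.
  rewrite -(card_in_imset Finj); apply: subset_leq_card.
  apply/fintype.subsetP => _ /imsetP[q qD ->].
  by rewrite !inE andbT; case: (FP q qD).
by rewrite !cardsX !cardsT !card_ffun !card_ord.
Qed.

(* The slack [l^2 - (k^2 - p^2) >= 1] absorbs the rounding error, which is of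
   order [n] whereas the squared radius is a large multiple of [n]. *)
Lemma card_cap (k p l n : nat) (x : 'I_n -> int) :
  (0 < k)%N -> (0 < l)%N -> (k ^ 2 < p ^ 2 + l ^ 2)%N ->
  let s := (2 * (2 * k ^ 2 + 1) * (k + l) ^ 2 * n)%N in
  (#|[set y : grid n s |
       (\sum_j (k%:Z * coord y j - p%:Z * x j) ^+ 2
         <= (k%:Z ^+ 2 - p%:Z ^+ 2) * s%:Z)%R]| * k ^ n
   <= #|grid_ball n s| * l ^ n)%N.
Proof.
move=> k0 l0 kpl; set s := (_ * n)%N; rewrite /=; apply: (@card_rescale _ _ _ _ (fun j => p%:Z * x j)) => //.
move=> u; rewrite inE => Hu v Hv; apply: grid_ballP.
set X := \sum_j _ in Hu.
(* [K] bounds the rounding error of a coordinate and [M] is the weight in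
   [(d + e)^2 <= (1 + 1/M) d^2 + (M + 1) e^2]. Here [M] and [s] are such that the two excess terms
   sum to at most [s / 2] each. *)
pose M : int := 2 * k%:Z ^+ 2; pose K : int := (k + l)%:Z.
have k1 : 0 < k%:Z ^+ 2 by rewrite exprn_gt0.
have M0 : 0 < M by rewrite /M; lia.
have Mk : 2 * (k%:Z ^+ 2 - p%:Z ^+ 2) <= M.
  by rewrite /M; have := sqr_ge0 p%:Z; lia.
have sE : s%:Z = 2 * (M + 1) * K ^+ 2 * n%:Z.
  by rewrite /s /M /K !PoszM !PoszD !PoszM; ring.
have kpl' : k%:Z ^+ 2 - p%:Z ^+ 2 + 1 <= l%:Z ^+ 2 by move: kpl; rewrite !expr2; lia.
clearbody M.
have step : M * l%:Z ^+ 2 * (\sum_j v j ^+ 2) <=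
    (M + 1) * X + M * (M + 1) * K ^+ 2 * n%:Z.
  have -> : M * (M + 1) * K ^+ 2 * n%:Z = \sum_(j < n) M * (M + 1) * K ^+ 2.
    by rewrite sumr_const card_ord -mulr_natr natz.
  rewrite /X !mulr_sumr -big_split /=; apply: ler_sum => j _.
  set d := k%:Z * _ - _.
  have Hd : `|l%:Z * v j - d| <= K by exact: Hv.
  set e := l%:Z * v j - d in Hd.
  have He : e ^+ 2 <= K ^+ 2.
    by rewrite -(real_normK (num_real e)) ler_pXn2r ?nnegrE.
  have -> : M * l%:Z ^+ 2 * v j ^+ 2 = M * (d + e) ^+ 2 by rewrite /e; ring.
  (* The weighted inequality, multiplied by [M] to stay in the integers, with its defect as a
     square. *)
  have -> : M * (d + e) ^+ 2 =
      (M + 1) * d ^+ 2 + M * (M + 1) * e ^+ 2 - (d - M * e) ^+ 2 by ring.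
  rewrite lerBlDr ler_wpDr ?sqr_ge0 // lerD2l ler_pM2l //.
  by rewrite mulr_gt0 //; lia.
rewrite -(@ler_pM2l _ (M * l%:Z ^+ 2)); last by rewrite mulr_gt0 // exprn_gt0.
apply: le_trans step _.
have h1 : (M + 1) * X <= (M + 1) * ((k%:Z ^+ 2 - p%:Z ^+ 2) * s%:Z).
  by rewrite ler_pM2l //; lia.
have h2 : M * (k%:Z ^+ 2 - p%:Z ^+ 2 + 1) * s%:Z <= M * l%:Z ^+ 2 * s%:Z.
  by rewrite ler_wpM2r // ler_pM2l.
have h3 : 2 * (M * (M + 1) * K ^+ 2 * n%:Z) = M * s%:Z by rewrite sE; ring.
have h4 : 2 * ((k%:Z ^+ 2 - p%:Z ^+ 2) * s%:Z) <= M * s%:Z.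
  by rewrite mulrA ler_wpM2r.
move: h1 h2 h3 h4; clear; move: (s%:Z) (K ^+ 2) => t K2.
move: (_ - _) (l%:Z ^+ 2) => D l2; lia.
Qed.

(** * Greedy choice of a code *)

(** For a maximal [C] without bad pairs, the bad neighbourhoods of its points cover [B]. Summing
    their sizes and cancelling [#|B|] gives the bound. *)
Lemma maximal_independent (T : finType) (B : {set T}) (bad : rel T) (m d : nat) :
  symmetric bad -> {in B, reflexive bad} ->
  (forall x, x \in B -> (#|[set y in B | bad x y]| * m <= #|B| * d)%N) ->
  (0 < #|B|)%N ->
  exists C : {set T}, [/\ C \subset B,
    {in C &, forall x y, x != y -> ~~ bad x y} & (m <= #|C| * d)%N].
Proof.
move=> sym refl H B0.
pose indep (C : {set T}) := (C \subset B) &&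
  [forall x in C, forall y in C, (x != y) ==> ~~ bad x y].
have indepP (C : {set T}) : reflect (C \subset B /\
    {in C &, forall x y, x != y -> ~~ bad x y}) (indep C).
  apply: (iffP andP) => -[CB Ci]; split=> //.
    move=> x y xC yC xy; move: Ci => /forall_inP/(_ x xC)/forall_inP/(_ y yC).
    by move/implyP; apply.
  apply/forall_inP => x xC; apply/forall_inP => y yC; apply/implyP.
  exact: Ci.
have [C /maxsetP[/indepP[CB Ci] Cmax] _] : {C | maxset indep C & finset.set0 \subset C}.
  apply: maxset_exists; apply/indepP; split; first exact: finset.sub0set.
  by move=> x y; rewrite inE.
exists C; split=> //.
have cov : B \subset \bigcup_(x in C) [set y in B | bad x y].
  apply/fintype.subsetP => y yB; apply/bigcupP.
  have [yC|yC] := boolP (y \in C); first by exists y; rewrite // inE yB refl.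
  have [[x xC xy]|none] := @exists_inP _ (mem C) (bad^~ y).
    by exists x => //; rewrite inE yB.
  (* A point [y] outside all these neighbourhoods could be added to [C], against maximality. *)
  have : indep (y |: C).
    apply/indepP; split; first by rewrite finset.subUset finset.sub1set yB.
    move=> a b; rewrite !inE => /orP[/eqP->|aC] /orP[/eqP->|bC]; rewrite ?eqxx //.
    - by move=> _; apply/negP => yb; apply: none; exists b; rewrite // sym.
    - by move=> _; apply/negP => ay; apply: none; exists a.
    - exact: Ci.
  move=> /Cmax/(_ (finset.subsetUr _ _)) E; move: yC; rewrite -E !inE eqxx.
  by [].
rewrite -(@leq_pmul2l #|B|) //.
apply: (@leq_trans (\sum_(x in C) (#|[set y in B | bad x y]| * m))%N).
  rewrite -big_distrl /= leq_mul2r; apply/orP; right.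
  apply: leq_trans (subset_leq_card cov) _; elim/big_rec2: _ => [|x c A _ le]; first by rewrite cards0.
  by apply: leq_trans (leq_card_setU _ _) _; rewrite leq_add2l.
apply: (@leq_trans (\sum_(x in C) #|B| * d)%N).
  by apply: leq_sum => x xC; apply: H; apply: (fintype.subsetP CB).
by rewrite sum_nat_const; lia.
Qed.

(** * Inner products and the average squared radius *)

Section dot_product.
Variable R : realType.
Implicit Types n L : nat.

Definition dot n (x y : 'rV[R]_n) : R := \sum_j x 0 j * y 0 j.

Lemma dotxx n (x : 'rV[R]_n) : dot x x = sqnorm x.
Proof. by apply: eq_bigr => j _; rewrite expr2. Qed.

Lemma dotC n (x y : 'rV[R]_n) : dot x y = dot y x.
Proof. by apply: eq_bigr => j _; rewrite mulrC. Qed.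

Lemma dot_suml n L (x : 'I_L -> 'rV[R]_n) y :
  dot (\sum_i x i) y = \sum_i dot (x i) y.
Proof.
rewrite /dot exchange_big; apply: eq_bigr => j _.
by rewrite summxE mulr_suml.
Qed.

Lemma dotZ n a b (x y : 'rV[R]_n) : dot (a *: x) (b *: y) = a * b * dot x y.
Proof. by rewrite /dot mulr_sumr; apply: eq_bigr => j _; rewrite !mxE; ring. Qed.

Lemma dot_row_mx n m (x x' : 'rV[R]_n) (y y' : 'rV[R]_m) :
  dot (row_mx x y) (row_mx x' y') = dot x x' + dot y y'.
Proof.
rewrite /dot big_split_ord; congr (_ + _); apply: eq_bigr => j _.
  by rewrite !row_mxEl.
by rewrite !row_mxEr.
Qed.

Lemma sqnorm_ge0 n (x : 'rV[R]_n) : 0 <= sqnorm x.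
Proof. by apply: sumr_ge0 => j _; exact: sqr_ge0. Qed.

Lemma sqnorm_row_mx n m (x : 'rV[R]_n) (y : 'rV[R]_m) :
  sqnorm (row_mx x y) = sqnorm x + sqnorm y.
Proof. by rewrite -!dotxx dot_row_mx. Qed.

Lemma sqnorm_sub n a b (x y : 'rV[R]_n) :
  sqnorm (a *: x - b *: y) =
    a ^+ 2 * sqnorm x - 2 * a * b * dot x y + b ^+ 2 * sqnorm y.
Proof.
rewrite /sqnorm /dot !mulr_sumr -sumrB -big_split /=.
by apply: eq_bigr => j _; rewrite !mxE; ring.
Qed.

Lemma avgrad2E n L (x : 'I_L -> 'rV[R]_n) : (0 < L)%N ->
  avgrad2 x =
    L%:R^-1 * (\sum_i sqnorm (x i)) - L%:R^-1 ^+ 2 * sqnorm (\sum_i x i).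
Proof.
move=> L0; have LR : L%:R != 0 :> R by rewrite pnatr_eq0 -lt0n.
rewrite /avgrad2 /centroid; 
under eq_bigr do rewrite -[X in sqnorm (X - _)]scale1r sqnorm_sub expr1n mul1r.
rewrite big_split sumrB /= -mulr_sumr -dot_suml dotxx sumr_const card_ord.
by rewrite -mulr_natr; field.
Qed.

(** With equal norms, [avgrad2 x] is [rho] minus the squared norm of the sum over [L^2]. That
    squared norm expands into [L] terms [rho] and [L (L - 1)] inner products below [c * rho]; the
    latter exist since [2 <= L], so the inequality is strict. *)
Lemma avgrad2_sphere n L (x : 'I_L -> 'rV[R]_n) (rho c : R) : (2 <= L)%N ->
  (forall i, sqnorm (x i) = rho) ->
  (forall i j, i != j -> dot (x i) (x j) < c * rho) ->
  (L%:R - 1) / L%:R * (1 - c) * rho < avgrad2 x.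
Proof.
move=> L2 Hn Hd; have L0 : 0 < L%:R :> R by rewrite ltr0n; lia.
rewrite avgrad2E; last lia.
have -> : \sum_i sqnorm (x i) = L%:R * rho.
  by under eq_bigr do rewrite Hn; rewrite sumr_const card_ord mulr_natl.
have H : sqnorm (\sum_i x i) < L%:R * (rho + (L%:R - 1) * (c * rho)).
  rewrite -dotxx dot_suml mulr_natl -[X in _ *+ X](card_ord L) -sumr_const.
  apply: ltr_sum => [|i _].
    by apply/hasP; exists (Ordinal (ltnW L2 : (0 < L)%N)); rewrite // mem_index_enum.
  rewrite dotC dot_suml (bigD1 i) //= dotxx Hn ltrD2l.
  have -> : (L%:R - 1) * (c * rho) = \sum_(j < L | j != i) c * rho.
    rewrite sumr_const cardC1 card_ord -subn1 -[RHS]mulr_natl natrB //; lia.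
  apply: ltr_sum => [|j ji]; last exact: Hd.
  have : (0 < #|predC1 i|)%N by rewrite cardC1 card_ord; lia.
  move=> /card_gt0P[j ji]; apply/hasP; exists j => //; exact: mem_index_enum.
rewrite -subr_gt0.
have -> : L%:R^-1 * (L%:R * rho) - L%:R^-1 ^+ 2 * sqnorm (\sum_i x i) -
    (L%:R - 1) / L%:R * (1 - c) * rho =
  L%:R^-1 ^+ 2 * (L%:R * (rho + (L%:R - 1) * (c * rho)) - sqnorm (\sum_i x i)).
  by field; rewrite gt_eqF.
by rewrite mulr_gt0 ?subr_gt0 // exprn_gt0 // invr_gt0.
Qed.

End dot_product.

(** * Spherical codes from lifted integer points *)

Lemma spherical_code (R : realType) (k p l n : nat) (rho : R) :
  (0 < l)%N -> (0 < n)%N -> (p <= k)%N -> (k ^ 2 < p ^ 2 + l ^ 2)%N ->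
  0 < rho ->
  exists C : seq 'rV[R]_(n + 1),
    [/\ uniq C, {in C, forall x, sqnorm x = rho},
        {in C &, forall x y, x != y -> k%:R * dot x y < p%:R * rho} &
        (k ^ n <= size C * l ^ n)%N].
Proof.
move=> l0 n0 pk kpl rho0.
have [->|k0] := posnP k.
  by exists [::]; split=> //; rewrite exp0n.
pose s := (2 * (2 * k ^ 2 + 1) * (k + l) ^ 2 * n)%N.
have s0 : 0 < s%:R :> R.
  rewrite ltr0n /s muln_gt0 n0 andbT muln_gt0 expn_gt0 addn_gt0 k0 andbT; lia.
pose real_vec (u : grid n s) : 'rV[R]_n := \row_j (coord u j)%:~R.
pose lift u : 'rV[R]_(n + 1) :=
  row_mx (real_vec u) (const_mx (Num.sqrt (s%:R - sqnorm (real_vec u)))).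
have ballP u : u \in grid_ball n s -> sqnorm (real_vec u) <= s%:R.
  rewrite inE -(ler_int R) rmorph_sum /= pmulrn => H.
  by apply: le_trans H; apply: ler_sum => j _; rewrite mxE rmorphXn.
have liftn u : u \in grid_ball n s -> sqnorm (lift u) = s%:R.
  move=> /ballP uB; rewrite -dotxx dot_row_mx dotxx /dot big_ord1 !mxE.
  by rewrite -expr2 sqr_sqrtr ?subr_ge0 //; ring.
pose bad := [rel u v | p%:R * s%:R <= k%:R * dot (lift u) (lift v)].
have [|u uB|u uB||C [CB Cbad Csize]] :=
    @maximal_independent _ (grid_ball n s) bad (k ^ n) (l ^ n).
- by move=> u v; rewrite /bad /= dotC.
- by rewrite /bad /= dotxx liftn // ler_pM2r // ler_nat.
- apply: leq_trans (card_cap (fun j => coord u j) k0 l0 kpl).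
  rewrite leq_mul2r; apply/orP; right; apply/subset_leq_card/fintype.subsetP.
  move=> v; rewrite !inE => /andP[vB /= uv].
  have vB' : v \in grid_ball n s by rewrite inE.
  rewrite -(ler_int R) rmorph_sum /=.
  have -> : \sum_(j < n) ((k%:Z * coord v j - p%:Z * coord u j) ^+ 2)%:~R =
      sqnorm (k%:R *: real_vec v - p%:R *: real_vec u).
    apply: eq_bigr => j _; rewrite !mxE rmorphXn rmorphB !rmorphM /=.
    by rewrite -!pmulrn.
  (* Dropping the last coordinate does not increase the norm: the cap around [lift u] projects into
     the ball counted by [card_cap]. *)
  apply: (@le_trans _ _ (sqnorm (k%:R *: lift v - p%:R *: lift u))).
    rewrite !scale_row_mx opp_row_mx add_row_mx sqnorm_row_mx.
    by rewrite lerDl sqnorm_ge0.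
  rewrite sqnorm_sub !liftn // dotC intrM rmorphB !rmorphXn /= -!pmulrn.
  have := ler_wpM2l (ler0n R p) uv; rewrite -/s !mulrA.
  by move: (dot _ _) (s%:R : R) (k%:R : R) (p%:R : R) => d t k1 p1; lra.
- apply/card_gt0P; have [|u uB _] := @grid_ballP n s (fun=> 0); last by exists u.
  by rewrite expr0n sumr_const mul0rn.
(* Scaling by [a] takes squared norm [s] to [rho] and preserves cosines. *)
pose a := Num.sqrt (rho / s%:R).
have a2 : a ^+ 2 = rho / s%:R by rewrite sqr_sqrtr // divr_ge0 // ltW.
have a0 : a != 0 by rewrite sqrtr_eq0 -ltNge divr_gt0.
have inj : injective (fun u => a *: lift u).
  move=> u v /(scalerI a0)/eq_row_mx[/rowP E _]; apply: coord_inj => j.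
  by have := E j; rewrite !mxE => /intr_inj.
exists [seq a *: lift u | u <- enum C]; split.
- by rewrite map_inj_uniq // enum_uniq.
- move=> _ /mapP[u uC ->]; rewrite -dotxx dotZ dotxx liftn.
    by rewrite -expr2 a2 divfK ?gt_eqF.
  by apply: (fintype.subsetP CB); rewrite mem_enum in uC.
- move=> _ _ /mapP[u uC ->] /mapP[v vC ->] uv.
  rewrite !mem_enum in uC vC.
  have nuv : u != v by apply: contraNneq uv => ->.
  have := Cbad u v uC vC nuv; rewrite /bad /= -ltNge dotZ -expr2 a2 => H.
  move: H; rewrite -(ltr_pM2r (divr_gt0 rho0 s0)).
  have -> : p%:R * s%:R * (rho / s%:R) = p%:R * rho by field; rewrite gt_eqF.
  by rewrite [k%:R * _ * _]mulrAC -[k%:R * _ * _]mulrA.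
- by rewrite size_map -cardE.
Qed.

(** * Choice of parameters and passage to the limit *)

Lemma limn_esup_ge (R : realType) (u : nat -> \bar R) (t : \bar R) (n0 : nat) :
  (forall n, (n0 <= n)%N -> (t <= u n)%E) -> (t <= limn_esup u)%E.
Proof.
move=> H; apply: le_ereal_inf_tmp => _ [V [m _ mV] <-].
apply: (@le_trans _ _ (u (maxn m n0))); first by apply: H; rewrite leq_maxr.
apply: ereal_sup_ubound; exists (maxn m n0) => //; apply: mV.
by rewrite /= leq_maxl.
Qed.

(** Truncating [c * k] and [tau * k] lowers the sum of squares by at most [2 (c + tau) k], while the
    surplus over [k^2] is [d * k^2]. *)
Lemma rational_point_outside_circle (R : realType) (c tau : R) :
  0 <= c <= 1 -> 0 < tau -> 1 < c ^+ 2 + tau ^+ 2 ->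
  exists k p l : nat,
    [/\ (0 < l)%N, (p <= k)%N, (k ^ 2 < p ^ 2 + l ^ 2)%N,
        p%:R <= c * k%:R & l%:R <= tau * k%:R].
Proof.
move=> /andP[c0 c1] tau0; rewrite -subr_gt0; set d := _ - 1 => d0.
(* The first term makes the surplus exceed the truncation loss; the second makes [tau * k > 1], so
   that [l > 0]. *)
set B := 2 * (c + tau) / d + tau^-1.
pose k := (Num.truncn B).+1.
have Bk : B < k%:R by exact: truncnS_gt.
have k0 : 0 < k%:R :> R by rewrite ltr0n.
clearbody k.
have ck0 : 0 <= c * k%:R by rewrite mulr_ge0 // ltW.
have tk0 : 0 <= tau * k%:R by rewrite mulr_ge0 // ltW.
have /andP[p1 p2] := truncn_itv ck0; have /andP[l1 l2] := truncn_itv tk0.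
have cd0 : 0 <= 2 * (c + tau) / d.
  by rewrite divr_ge0 ?(ltW d0) // mulr_ge0 // addr_ge0 // ltW.
exists k, (Num.truncn (c * k%:R)), (Num.truncn (tau * k%:R)); split => //.
- rewrite truncn_gt0 -ler_pdivrMl // mulr1; apply: ltW.
  by apply: le_lt_trans Bk; rewrite lerDr.
- rewrite -(ler_nat R); apply: le_trans p1 _.
  by rewrite ler_piMl // ltW.
- rewrite -(ltr_nat R) natrD !natrX.
  move: p1 p2 l1 l2; rewrite -!natr1.
  move=> p1 p2 l1 l2.
  have dk : 2 * (c + tau) < d * k%:R.
    rewrite [d * _]mulrC -ltr_pdivrMr //; apply: le_lt_trans Bk.
    by rewrite /B lerDl invr_ge0 ltW.
  have key (a x : R) : 0 <= x -> x <= a -> a < x + 1 -> a ^+ 2 - 2 * a <= x ^+ 2.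
    by move=> x0 xa ax; nra.
  have := key _ _ (ler0n R _) p1 p2; have := key _ _ (ler0n R _) l1 l2.
  have : k%:R * (2 * (c + tau)) < k%:R * (d * k%:R) by rewrite ltr_pM2l.
  by rewrite /d; lra.
Qed.

Theorem mainTheorem11 (R : realType) (L : nat) (P N : R)
  (hL : (2 <= L)%N) (hP : 0 < P) (hN : 0 < N)
  (hNP : N <= (L%:R - 1) / L%:R * P) :
  ((2 ^-1 * ln (((L%:R - 1) ^+ 2 * P ^+ 2) /
      (L%:R * N * (2 * (L%:R - 1) * P - L%:R * N))))%:E
   <= capListDec P N L)%E.
Proof.
have L0 : 0 < L%:R :> R by rewrite ltr0n ltnW.
have L1 : 0 < L%:R - 1 :> R by rewrite subr_gt0 ltr1n.
pose c : R := 1 - L%:R * N / ((L%:R - 1) * P).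
have cN : (L%:R - 1) / L%:R * (1 - c) * P = N.
  by rewrite /c; field; rewrite !gt_eqF.
have c1 : c < 1 by rewrite /c ltrBlDr ltrDl divr_gt0 // mulr_gt0.
have c0 : 0 <= c.
  rewrite /c subr_ge0 ler_pdivrMr ?mulr_gt0 // mul1r -ler_pdivlMl //.
  by apply: le_trans hNP _; rewrite le_eqVlt; apply/orP; left; apply/eqP; ring.
have c2 : 0 < 1 - c ^+ 2.
  by rewrite subr_gt0 expr_lt1.
have -> : (L%:R - 1) ^+ 2 * P ^+ 2 / (L%:R * N * (2 * (L%:R - 1) * P - L%:R * N))
    = (1 - c ^+ 2)^-1.
  have -> : 1 - c ^+ 2 = (L%:R * N * (2 * (L%:R - 1) * P - L%:R * N)) /
      ((L%:R - 1) ^+ 2 * P ^+ 2) by rewrite /c; field; rewrite !gt_eqF.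
  by rewrite invf_div.
set T := 2^-1 * ln _.
have ET : expR (- (2 * T)) = 1 - c ^+ 2.
  by rewrite /T mulrA divff ?mul1r // lnV ?posrE // opprK lnK.
clearbody T.
suff H (e : R) : 0 < e -> ((T - e)%:E <= capListDec P N L)%E.
  by apply/lee_subgt0Pr => e e0; rewrite -EFinB; exact: H.
move=> e0.
have [t0|t0] := leP (T - e) 0.
  (* A nonpositive target is met by the empty code, whose rate is 0 because [ln 0 = 0]. *)
  apply: (@limn_esup_ge _ _ _ 0) => n _; apply: (@le_trans _ _ 0%E); first by rewrite lee_fin.
  apply: ereal_sup_ubound; exists [::]; last by rewrite /rate ln0 ?mulr0.
  by split=> // x _ /(_ (Ordinal (ltnW hL))); rewrite in_nil.
(* [expR (- T)] is [sqrt (1 - c^2)]. Half of [e] pays for the rational approximation, the other half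
   for the dimension lost to the lift. *)
pose tau := expR (- (T - e / 2)).
have tau1 : 1 < c ^+ 2 + tau ^+ 2.
  rewrite /tau -expRM_natl.
  have -> : 2 * - (T - e / 2) = - (2 * T) + e by field.
  rewrite expRD ET -ltrBlDl -[X in X < _]mulr1 ltr_pM2l //.
  by rewrite -expR0 ltr_expR.
have [k [p [l [l0 pk kpl pc ltau]]]] :
  exists k p l : nat, [/\ (0 < l)%N, (p <= k)%N, (k ^ 2 < p ^ 2 + l ^ 2)%N,
        p%:R <= c * k%:R & l%:R <= tau * k%:R].
  by apply: rational_point_outside_circle; rewrite ?expR_gt0 // c0 ltW.
have k0 : (0 < k)%N.
  rewrite lt0n; apply: contraTneq ltau => ->.
  by rewrite mulr0 -ltNge ltr0n.
have k0' : 0 < k%:R :> R by rewrite ltr0n.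
(* With [n = m + 1], this threshold gives [T - e <= m * (e / 2)], hence
   [(m + 1) (T - e) <= m (T - e / 2)], and also [0 < m]. *)
apply: (@limn_esup_ge _ _ _ (Num.truncn ((T - e) / (e / 2))).+2) => n.
case: n => // m; rewrite ltnS -[m.+1]addn1 => hm.
have hm' : T - e <= m%:R * (e / 2).
  rewrite -ler_pdivrMr ?divr_gt0 //; apply: ltW.
  by apply: lt_le_trans (truncnS_gt _) _; rewrite ler_nat.
have m0 : (0 < m)%N by apply: leq_trans hm.
pose rho : R := (m + 1)%:R * P.
have rho0 : 0 < rho by rewrite mulr_gt0 // ltr0n addn1.
have [C [uC Cn Cdot Csize]] := spherical_code l0 m0 pk kpl rho0.
have Clarge : expR (m%:R * (T - e / 2)) <= (size C)%:R.
  have : k%:R ^+ m <= (size C)%:R * (tau * k%:R) ^+ m.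
    apply: (@le_trans _ _ ((size C)%:R * l%:R ^+ m)).
      by rewrite -!natrX -natrM ler_nat.
    by rewrite ler_wpM2l // lerXn2r ?nnegrE // mulr_ge0 ?expR_ge0.
  rewrite exprMn mulrA -[X in X <= _]mul1r ler_pM2r ?exprn_gt0 //.
  rewrite /tau expRN exprVn -expRM_natl ler_pdivlMr ?expR_gt0 // mul1r.
  by [].
apply: (@le_trans _ _ (rate C)%:E).
  rewrite lee_fin /rate ler_pdivlMl ?ltr0n ?addn1 //.
  apply: (@le_trans _ _ (m%:R * (T - e / 2))).
    by rewrite natrD; move: (m%:R : R) hm' => M; lra.
  rewrite -[X in X <= _]expRK ler_ln ?posrE ?expR_gt0 //.
  by rewrite (lt_le_trans _ Clarge) ?expR_gt0.
apply: ereal_sup_ubound; exists C => //; split; first split=> //.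
  by move=> x xC; rewrite /inBall sqr_sqrtr ?(ltW rho0) // Cn.
move=> x xinj xC.
have -> : (m + 1)%:R * N = (L%:R - 1) / L%:R * (1 - c) * rho.
  by rewrite -[in LHS]cN /rho; ring.
apply: avgrad2_sphere => // [i|i j ij]; first exact: Cn.
have xij : x i != x j by rewrite (inj_eq xinj).
(* The cosines are below [p / k], which is at most [c]. *)
rewrite -(ltr_pM2l k0'); apply: lt_le_trans (Cdot _ _ (xC i) (xC j) xij) _.
by rewrite [k%:R * _]mulrA [k%:R * c]mulrC ler_pM2r.
Qed.
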